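(* Let $(X,J)$ be a modal space. Then there is an operation $\rightarrow\, : X\times X\to X$ such that for all $a,b,c\in X$, $$Jc\wedge a\le b \iff c\le a\rightarrow b .$$ In other words, for every $a\in X$ the monotone map $J(-)\wedge a$ is left adjoint to $a\rightarrow(-)$.
   Context: A locale $X$ is identified with its frame: a complete lattice in which finite meets distribute over arbitrary joins. A modal space is a pair $(X,J)$ where $X$ is a locale and $J:X\to X$ is a monotone function preserving all joins. *)

(* Defs.v *)
From HB Require Import structures.
From mathcomp Require Import all_boot all_order boolp classical_sets.
Set Implicit Arguments.
Unset Strict Implicit.
Unset Printing Implicit Defensive.
Import Order.TTheory.
Local Open Scope order_scope.

(* [lub A] and [glb A] are unique by antisymmetry, so carrying them as
   operations is no extra structure; [lub set0] is necessarily [\bot]. *)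
HB.mixin Record isCompleteLattice d T of Order.TBLattice d T := {
  lub : set T -> T;
  glb : set T -> T;
  lubP : forall A : set T, supremums A (lub A);
  glbP : forall A : set T, infimums A (glb A)
}.

#[short(type="completeLatticeType")]
HB.structure Definition CompleteLattice d :=
  { T of Order.TBLattice d T & isCompleteLattice d T }.

HB.mixin Record CompleteLattice_isFrame d T of CompleteLattice d T := {
  meet_lub : forall (a : T) (A : set T),
    a `&` lub A = lub (Order.meet a @` A)%classic
}.

#[short(type="frameType")]
HB.structure Definition Frame d :=
  { T of CompleteLattice d T & CompleteLattice_isFrame d T }.

Record modalSpace (d : Order.disp_t) := ModalSpace {
  locale_of :> frameType d;
  modal : locale_of -> locale_of;
  modal_mono : {homo modal : x y / x <= y};
  modal_lub : forall A : set locale_of, modal (lub A) = lub (modal @` A)%classic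
}.

Definition left_adjoint d d' (P : porderType d) (Q : porderType d')
    (f : P -> Q) (g : Q -> P) : Prop :=
  [/\ {homo f : x y / x <= y}, {homo g : x y / x <= y}
    & forall x y, f x <= y <-> x <= g y].

(* Main.v *)
(* The implication [a -> b] is the join of all [c] with [J c /\ a <= b]; it
   satisfies the defining inequality itself because both [J] and [_ /\ a]
   preserve joins. *)
Require Import Defs.
From mathcomp Require Import all_boot all_order boolp classical_sets.
Import Order.TTheory.
Local Open Scope order_scope.

(** This is the adjoint functor theorem for complete lattices: a join-preserving map has a right
    adjoint, sending [b] to the join of all elements mapped below [b]. *)

Lemma le_lub {d} {T : completeLatticeType d} (A : set T) (x : T) :
  A x -> x <= lub A.
Proof. by case: (lubP A) => + _; apply. Qed.

Lemma lub_le {d} {T : completeLatticeType d} (A : set T) (y : T) :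
  (forall x, A x -> x <= y) -> lub A <= y.
Proof. by case: (lubP A) => _; apply. Qed.

Definition modal_imp {d} {X : modalSpace d} (a b : X) : X :=
  lub [set c : X | (modal c `&` a <= b)%O]%classic.

Lemma modal_impP {d} {X : modalSpace d} (a b c : X) :
  modal c `&` a <= b <-> c <= modal_imp a b.
Proof.
split=> [|le_c]; first exact: (@le_lub _ X).
(* By monotonicity, only the largest candidate [c = modal_imp a b] matters. *)
apply: (@le_trans _ _ (modal (modal_imp a b) `&` a)).
  exact: leI2 (modal_mono le_c) (lexx a).
rewrite /modal_imp modal_lub meetC meet_lub.
apply: lub_le => _ [_ [x xab <-] <-].
by rewrite meetC.
Qed.

Theorem theorem3p6 (d : Order.disp_t) (X : modalSpace d) :
  exists imp : X -> X -> X,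
    (forall a b c : X, modal c `&` a <= b <-> c <= imp a b) /\
    (forall a : X, left_adjoint (fun c : X => modal c `&` a) (imp a)).
Proof.
exists (@modal_imp d X); split=> [a b c | a]; first exact: modal_impP.
split=> [x y le_xy | x y le_xy | x y]; last exact: modal_impP.
  exact: leI2 (modal_mono le_xy) (lexx a).
(* Transposing reduces this to the counit at [x], followed by [x <= y]. *)
by apply/modal_impP; apply: le_trans le_xy; apply/modal_impP.
Qed.
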